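(* Let $R$ be a commutative ring with a unit element, $\operatorname{char}R=\ell$, where either $\ell$ is an odd natural number or $\ell=0$, and let $G_R$ be the Grassmann algebra over $R$. Then for all $m\in\mathbb N$, with $\lambda=(1^{2m})$, there is an isomorphism of $\mathbb ZS_{2m}$-modules $$\frac{\Gamma_{2m}(\mathbb Z)}{\Gamma_{2m}(\mathbb Z)\cap\operatorname{Id}(G_R,\mathbb Z)}\cong S(\lambda)/\ell S(\lambda),$$ and $$\frac{\Gamma_{2m+1}(\mathbb Z)}{\Gamma_{2m+1}(\mathbb Z)\cap\operatorname{Id}(G_R,\mathbb Z)}=0\quad\text{for all }m\in\mathbb Z_+.$$
   Context: $\mathbb N=\{1,2,\dots\}$, $\mathbb Z_+=\{0,1,2,\dots\}$. $\operatorname{char}R$ is the least $n\in\mathbb N$ with $n1_R=0$, or $0$ if there is none. The Grassmann algebra $G_R$ is the (associative) $R$-algebra with unit generated by the countable set of generators $e_i$, $i\in\mathbb N$, subject to the anti-commutative relations $e_ie_j=-e_je_i$, $i,j\in\mathbb N$. $\mathbb Z\langle X\rangle$ is the free associative ring without $1$ on $X=\{x_1,x_2,\dots\}$. For a ring $A$, $\operatorname{Id}(A,\mathbb Z)\subseteq\mathbb Z\langle X\rangle$ is the set of $f$ with $f(a_1,\dots,a_n)=0$ for all $a_i\in A$. $P_n(\mathbb Z)$ is the additive subgroup of $\mathbb Z\langle X\rangle$ generated by $x_{\sigma(1)}\cdots x_{\sigma(n)}$, $\sigma\in S_n$; $S_n$ acts by permuting the variables. $\Gamma_n(\mathbb Z)\subseteq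 P_n(\mathbb Z)$ is the $\mathbb ZS_n$-submodule of proper polynomials, i.e. of linear combinations of products of long commutators (of length $\geqslant2$, left normed); $\Gamma_1(\mathbb Z)=0$. $(1^{k})$ is the partition of $k$ with $k$ parts equal to $1$. For a Young tableau $T_\lambda$ of shape $\lambda\vdash n$ with row stabilizer $R_{T_\lambda}$ and column stabilizer $C_{T_\lambda}$, let $a_{T_\lambda}=\sum_{\pi\in R_{T_\lambda}}\pi$, $b_{T_\lambda}=\sum_{\sigma\in C_{T_\lambda}}(\operatorname{sign}\sigma)\sigma$; the integral Specht module is $S(\lambda):=(\mathbb ZS_n)b_{T_\lambda}a_{T_\lambda}$, which up to isomorphism does not depend on $T_\lambda$. *)

(* Defs.v *)
From HB Require Import structures.
From mathcomp Require Import all_boot all_order all_algebra all_fingroup.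
From mathcomp Require Import finmap generic_quotient ring_quotient boolp.
From mathcomp Require Import monalg.

Set Implicit Arguments.
Unset Strict Implicit.
Unset Printing Implicit Defensive.

Import GRing.Theory.

Local Open Scope ring_scope.

(* The trivial ring has characteristic 1. *)
Definition has_char (R : pzRingType) (l : nat) : Prop :=
  [/\ (0 < l)%N, l%:R = 0 :> R & forall k, (0 < k)%N -> k%:R = 0 :> R -> (l <= k)%N]
  \/ l = 0%N /\ forall k, (0 < k)%N -> k%:R <> 0 :> R.

Inductive subgroup_gen (V : zmodType) (S : V -> Prop) : V -> Prop :=
| subgroup_gen0 : subgroup_gen S 0
| subgroup_genS x of S x : subgroup_gen S x
| subgroup_genB x y of subgroup_gen S x & subgroup_gen S y :
    subgroup_gen S (x - y).

Record submodule (A : pzRingType) (M : lmodType A) := Submodule {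
  submodule_pred :> {pred M};
  submoduleP : subsemimod_closed submodule_pred
}.

HB.instance Definition _ (A : pzRingType) (M : lmodType A) (N : submodule M) :=
  GRing.isSubmodClosed.Build A M (submodule_pred N) (submoduleP N).

Section Submodules.
Variables (A : pzRingType) (M : lmodType A).

Definition cap_pred (U N : submodule M) : {pred M} :=
  fun x => (x \in U) && (x \in N).

Lemma cap_closed U N : subsemimod_closed (cap_pred U N).
Proof.
split; first split.
- by rewrite unfold_in /cap_pred !rpred0.
- by move=> x y /andP[xU xN] /andP[yU yN]; rewrite unfold_in /cap_pred !rpredD.
- by move=> a x /andP[xU xN]; rewrite unfold_in /cap_pred !rpredZ.
Qed.

Definition cap (U N : submodule M) : submodule M := Submodule (cap_closed U N).

Definition nmul_pred (l : nat) (U : submodule M) : {pred M} :=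
  fun x => `[< exists2 y, y \in U & x = y *+ l >].

Lemma nmul_closed l U : subsemimod_closed (nmul_pred l U).
Proof.
split; first split.
- by apply/asboolP; exists 0; rewrite ?rpred0 ?mul0rn.
- move=> _ _ /asboolP[u uS ->] /asboolP[v vS ->]; apply/asboolP.
  by exists (u + v); rewrite ?rpredD ?mulrnDl.
- move=> a _ /asboolP[u uS ->]; apply/asboolP.
  by exists (a *: u); rewrite ?rpredZ ?scalerMnr.
Qed.

Definition nmul (l : nat) (U : submodule M) : submodule M :=
  Submodule (nmul_closed l U).

End Submodules.

Section QuotientModule.
Variables (A : pzRingType) (M : lmodType A) (N : submodule M).

Definition modquot : Type := Quotient.quot (submodule_pred N).

HB.instance Definition _ := GRing.Zmodule.on modquot.

Definition modquot_pi (x : M) : modquot :=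
  \pi_(Quotient.quot (submodule_pred N))%qT x.

Definition modquot_repr (q : modquot) : M :=
  repr (q : Quotient.quot (submodule_pred N)).

Definition modquot_scale (a : A) (q : modquot) : modquot :=
  modquot_pi (a *: modquot_repr q).

Lemma modquot_piE x y : modquot_pi x = modquot_pi y <-> x - y \in N.
Proof.
rewrite /modquot_pi [_ \in _](Quotient.idealrBE (submodule_pred N) x y).
by split=> [->|/eqP].
Qed.

Lemma modquot_piK : cancel modquot_repr modquot_pi.
Proof. exact: reprK. Qed.

Lemma modquot_pi_is_zmod_morphism : zmod_morphism modquot_pi.
Proof. by move=> x y; rewrite /modquot_pi raddfB. Qed.

HB.instance Definition _ :=
  GRing.isZmodMorphism.Build M modquot modquot_pi modquot_pi_is_zmod_morphism.

Lemma modquot_scale_pi a x :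
  modquot_scale a (modquot_pi x) = modquot_pi (a *: x).
Proof.
apply/modquot_piE; rewrite -scalerBr rpredZ //.
by apply/modquot_piE; rewrite modquot_piK.
Qed.

Lemma modquot_scalerA a b q :
  modquot_scale a (modquot_scale b q) = modquot_scale (a * b) q.
Proof. by rewrite -[q]modquot_piK !modquot_scale_pi scalerA. Qed.

Lemma modquot_scale1r : left_id 1 modquot_scale.
Proof. by move=> q; rewrite -[q]modquot_piK modquot_scale_pi scale1r. Qed.

Lemma modquot_scalerDr : right_distributive modquot_scale +%R.
Proof.
move=> a p q; rewrite -[p]modquot_piK -[q]modquot_piK.
by rewrite -raddfD !modquot_scale_pi scalerDr raddfD.
Qed.

Lemma modquot_scalerDl q : {morph modquot_scale^~ q : a b / a + b}.
Proof.
by move=> a b; rewrite -[q]modquot_piK !modquot_scale_pi scalerDl raddfD.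
Qed.

HB.instance Definition _ := GRing.Zmodule_isLmodule.Build A modquot
  modquot_scalerA modquot_scale1r modquot_scalerDr modquot_scalerDl.

Lemma modquot_pi_is_scalable : scalable modquot_pi.
Proof. by move=> a x; rewrite -modquot_scale_pi. Qed.

HB.instance Definition _ :=
  GRing.isScalable.Build A M modquot *:%R modquot_pi modquot_pi_is_scalable.

End QuotientModule.

(* A submodule U as a module in its own right, and the trace on it of N; when *)
(* N is contained in U, [subquot U N] is U / N.                               *)
Section Subquotient.
Variables (A : pzRingType) (M : lmodType A) (U N : submodule M).

Record submod : predArgType := Submod { submod_val :> M; _ : submod_val \in U }.

HB.instance Definition _ := [isSub for submod_val].
HB.instance Definition _ := [Choice of submod by <:].
HB.instance Definition _ := [SubChoice_isSubLmodule of submod by <:].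

Definition trace_pred : {pred submod} := fun x => val x \in N.

Lemma trace_closed : subsemimod_closed trace_pred.
Proof.
split; first split.
- by rewrite unfold_in /trace_pred raddf0 rpred0.
- by move=> x y xN yN; rewrite unfold_in /trace_pred raddfD rpredD.
- by move=> a x xN; rewrite unfold_in /trace_pred linearZ rpredZ.
Qed.

Definition trace_submod : submodule submod := Submodule trace_closed.

Definition subquot : lmodType A := modquot trace_submod.

End Subquotient.

Definition mod_isomorphic (A : pzRingType) (M N : lmodType A) : Prop :=
  exists phi : {linear M -> N}, bijective phi.

Definition ZS (n : nat) : Type := {ffun 'S_n -> int}.

Section GroupRing.
Variable n : nat.

HB.instance Definition _ := GRing.Zmodule.on (ZS n).

(* The product of s and t in S_n is taken to be the composite s \o t (t acts  *)
(* first), so that S_n acts on the left on polynomials; in the library s \o t *)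
(* is written (t * s)%g.                                                      *)
Definition ZS_one : ZS n := [ffun s => (s == 1%g)%:R].
Definition ZS_mul (u v : ZS n) : ZS n :=
  [ffun g => \sum_(s : 'S_n) u s * v (g * s^-1)%g].

Lemma ZS_mulA : associative ZS_mul.
Proof.
move=> u v w; apply/ffunP=> g; rewrite !ffunE.
under eq_bigr => s _ do rewrite ffunE mulr_sumr.
under [RHS]eq_bigr => s _ do rewrite ffunE mulr_suml.
rewrite [RHS]exchange_big /=; apply: eq_bigr => s _.
rewrite [RHS](reindex_inj (mulIg s)) /=; apply: eq_bigr => t _.
by rewrite mulrA mulgK invMg mulgA.
Qed.

Lemma ZS_mul1r : left_id ZS_one ZS_mul.
Proof.
move=> u; apply/ffunP=> g; rewrite ffunE (bigD1 1%g) //= ffunE eqxx mul1r.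
rewrite invg1 mulg1 big1 ?addr0 // => s s1.
by rewrite ffunE (negbTE s1) mul0r.
Qed.

Lemma ZS_mulr1 : right_id ZS_one ZS_mul.
Proof.
move=> u; apply/ffunP=> g; rewrite ffunE (bigD1 g) //= ffunE mulgV eqxx mulr1.
rewrite big1 ?addr0 // => s sg.
by rewrite ffunE -eq_mulgV1 eq_sym (negbTE sg) mulr0.
Qed.

Lemma ZS_mulDl : left_distributive ZS_mul +%R.
Proof.
move=> u v w; apply/ffunP=> g; rewrite !ffunE -big_split /=.
by apply: eq_bigr => s _; rewrite ffunE mulrDl.
Qed.

Lemma ZS_mulDr : right_distributive ZS_mul +%R.
Proof.
move=> u v w; apply/ffunP=> g; rewrite !ffunE -big_split /=.
by apply: eq_bigr => s _; rewrite ffunE mulrDr.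
Qed.

HB.instance Definition _ := GRing.Zmodule_isPzRing.Build (ZS n)
  ZS_mulA ZS_mul1r ZS_mulr1 ZS_mulDl ZS_mulDr.

End GroupRing.

Definition is_partition (n : nat) (la : seq nat) : Prop :=
  [/\ sorted geq la, 0%N \notin la & sumn la = n].

Section Specht.
Variable n : nat.
Implicit Types (T : seq (seq 'I_n)) (i : 'I_n).

(* A tableau is the list of its rows, filled with 0, ..., n-1. *)
Definition is_tableau (la : seq nat) T : Prop :=
  [/\ is_partition n la, shape T = la & perm_eq (flatten T) (enum 'I_n)].

Definition row_of T i : nat := find (fun r : seq 'I_n => i \in r) T.
Definition col_of T i : nat := index i (nth [::] T (row_of T i)).

Definition row_stab T : {set 'S_n} :=
  [set s : 'S_n | [forall i, row_of T (s i) == row_of T i]].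
Definition col_stab T : {set 'S_n} :=
  [set s : 'S_n | [forall i, col_of T (s i) == col_of T i]].

Definition tab_a T : ZS n := [ffun s => (s \in row_stab T)%:R].
Definition tab_b T : ZS n :=
  [ffun s : 'S_n => if s \in col_stab T then (-1) ^+ odd_perm s else 0].

Definition specht_pred T : {pred (ZS n)^o} :=
  fun x => `[< exists u : ZS n, x = u * (tab_b T * tab_a T) >].

Lemma specht_closed T : subsemimod_closed (specht_pred T).
Proof.
split; first split.
- by apply/asboolP; exists 0; rewrite mul0r.
- move=> _ _ /asboolP[u ->] /asboolP[v ->]; apply/asboolP.
  by exists (u + v); rewrite mulrDl.
- move=> a _ /asboolP[u ->]; apply/asboolP.
  by exists (a * u); rewrite -[_ *: _]/(a * _) mulrA.
Qed.

Definition specht T : submodule (ZS n)^o := Submodule (specht_closed T).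

End Specht.

(* The free associative ring WITH 1 on x_0, x_1, ...; Z<X> is the ideal of    *)
(* the elements with zero constant term.                                      *)
Notation freeZ1 := {malg int[{fmonom nat}]}.

Definition monom (w : seq nat) : freeZ1 := << FMonom w >>.
Definition var (i : nat) : freeZ1 := monom [:: i].

Definition in_freeZ (f : freeZ1) : Prop := f@_(FMonom [::]) = 0.

Section Eval.
Variables (A : pzRingType) (a : nat -> A).

Definition peval (f : freeZ1) : A :=
  \sum_(w <- msupp f) (\prod_(i <- (w : seq nat)) a i) *~ f@_w.

Lemma pevalEw (d : {fset {fmonom nat}}) (f : freeZ1) : (msupp f `<=` d)%fset ->
  peval f = \sum_(w <- d) (\prod_(i <- (w : seq nat)) a i) *~ f@_w.
Proof.
move=> le; rewrite /peval (big_fset_incl _ le) //= => x xd /mcoeff_outdom ->.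
by rewrite mulr0z.
Qed.

Lemma peval_is_zmod_morphism : zmod_morphism peval.
Proof.
move=> f g; pose d := (msupp f `|` msupp g)%fset.
rewrite (@pevalEw d) ?msuppB_le // (@pevalEw d f) ?fsubsetUl //.
rewrite (@pevalEw d g) ?fsubsetUr // -sumrB; apply: eq_bigr => w _.
by rewrite mcoeffB mulrzBr.
Qed.

HB.instance Definition _ :=
  GRing.isZmodMorphism.Build freeZ1 A peval peval_is_zmod_morphism.

Lemma pevalU c (w : {fmonom nat}) :
  peval << c *g w >> = (\prod_(i <- (w : seq nat)) a i) *~ c.
Proof. by rewrite (pevalEw msuppU_le) big_seq_fset1 mcoeffUU. Qed.

Lemma peval_monom w : peval (monom w) = \prod_(i <- w) a i.
Proof. by rewrite pevalU mulr1z. Qed.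

Lemma peval_var i : peval (var i) = a i.
Proof. by rewrite peval_monom big_seq1. Qed.

Lemma pevalM f g : peval (f * g) = peval f * peval g.
Proof.
rewrite malgME raddf_sum [peval f]/peval mulr_suml /=; apply: eq_bigr => i _.
rewrite raddf_sum [peval g]/peval mulr_sumr /=; apply: eq_bigr => j _.
rewrite pevalU [mmul i j]fmmulE big_cat /= mulrzAl mulrzAr -mulrzA.
by rewrite mulrC.
Qed.

Lemma peval1 : peval 1 = 1.
Proof. by rewrite pevalU mulr1z fm1 big_nil. Qed.

HB.instance Definition _ :=
  GRing.isMonoidMorphism.Build freeZ1 A peval (conj peval1 pevalM).

End Eval.

(* S_n acts by substituting x_(s i) for x_i, i < n. *)
Definition perm_index (n : nat) (s : 'S_n) (i : nat) : nat :=
  oapp (fun j : 'I_n => s j : nat) i (insub i).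

Definition perm_vars (n : nat) (s : 'S_n) (f : freeZ1) : freeZ1 :=
  peval (fun i => var (perm_index s i)) f.

Lemma perm_index1 n i : perm_index (1%g : 'S_n) i = i.
Proof. by rewrite /perm_index; case: insubP => //= j _ <-; rewrite perm1. Qed.

Lemma perm_indexM n (s t : 'S_n) i :
  perm_index s (perm_index t i) = perm_index (t * s)%g i.
Proof.
rewrite /perm_index; case: (insubP _ i) => /= [j _ _|ni].
  by rewrite valK /= permM.
by rewrite insubN.
Qed.

Lemma prod_var (w : seq nat) : \prod_(i <- w) var i = monom w.
Proof.
elim: w => [|i w IH]; first by rewrite big_nil /monom -fmoneE.
by rewrite big_cons IH /var /monom malgM_def fgmulUU mulr1 [mmul _ _]fmmulE.
Qed.

Lemma perm_vars_monom n (s : 'S_n) w :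
  perm_vars s (monom w) = monom (map (perm_index s) w).
Proof. by rewrite /perm_vars peval_monom -prod_var big_map. Qed.

Lemma freeZ1_expand (f : freeZ1) : f = \sum_(w <- msupp f) monom w *~ f@_w.
Proof.
rewrite {1}[f]monalgE; apply: eq_bigr => w _.
by rewrite /monom fmK -raddfMz intz.
Qed.

Lemma peval_perm (A : pzRingType) (a : nat -> A) n (s : 'S_n) f :
  peval a (perm_vars s f) = peval (a \o perm_index s) f.
Proof.
rewrite /perm_vars [X in peval a X]/peval raddf_sum; apply: eq_bigr => w _.
rewrite raddfMz /=; congr (_ *~ _).
elim: (w : seq nat) => [|i v IH]; first by rewrite !big_nil peval1.
by rewrite !big_cons pevalM peval_var IH.
Qed.

Lemma peval_id f : peval var f = f.
Proof.
by rewrite {2}[f]freeZ1_expand; apply: eq_bigr => w _; rewrite prod_var.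
Qed.

Lemma eq_peval (A : pzRingType) (a b : nat -> A) : a =1 b -> peval a =1 peval b.
Proof.
move=> ab f; apply: eq_bigr => w _; congr (_ *~ _).
by apply: eq_bigr => i _; rewrite ab.
Qed.

Lemma perm_vars1 n f : perm_vars (1%g : 'S_n) f = f.
Proof. by rewrite -[RHS]peval_id; apply: eq_peval => i; rewrite perm_index1. Qed.

Lemma perm_varsM n (s t : 'S_n) f :
  perm_vars s (perm_vars t f) = perm_vars (t * s)%g f.
Proof.
rewrite {1}/perm_vars peval_perm; apply: eq_peval => i /=.
by rewrite perm_indexM.
Qed.

Lemma perm_vars_is_zmod_morphism n (s : 'S_n) : zmod_morphism (perm_vars s).
Proof. exact: raddfB. Qed.

HB.instance Definition _ n (s : 'S_n) :=
  GRing.isZmodMorphism.Build freeZ1 freeZ1 (perm_vars s)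
    (perm_vars_is_zmod_morphism s).

(* An alias, because the same ring is a ZS_n-module for every n. *)
Definition polyZS (n : nat) : Type := freeZ1.

Section ZSAction.
Variable n : nat.

Definition ZS_act (u : ZS n) (f : freeZ1) : freeZ1 :=
  \sum_(s : 'S_n) perm_vars s f *~ u s.

Lemma ZS_actA u v f : ZS_act u (ZS_act v f) = ZS_act (u * v) f.
Proof.
rewrite /ZS_act; under [RHS]eq_bigr => g _ do rewrite ffunE mulrz_sumr.
rewrite [RHS]exchange_big /=; apply: eq_bigr => s _.
rewrite [RHS](reindex_inj (mulIg s)) /= raddf_sum mulrz_suml.
apply: eq_bigr => t _.
by rewrite raddfMz /= perm_varsM mulgK -mulrzA mulrC.
Qed.

Lemma ZS_act1 : left_id 1 ZS_act.
Proof.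
move=> f; rewrite /ZS_act (bigD1 1%g) //= ffunE eqxx perm_vars1 mulr1z.
by rewrite big1 ?addr0 // => s s1; rewrite ffunE (negbTE s1) mulr0z.
Qed.

Lemma ZS_actDr : right_distributive ZS_act +%R.
Proof.
move=> u f g; rewrite /ZS_act -big_split /=; apply: eq_bigr => s _.
by rewrite raddfD mulrzDl.
Qed.

Lemma ZS_actDl f : {morph ZS_act^~ f : u v / u + v}.
Proof.
move=> u v; rewrite /ZS_act -big_split /=; apply: eq_bigr => s _.
by rewrite ffunE mulrzDr.
Qed.

HB.instance Definition _ := GRing.Zmodule.on (polyZS n).

HB.instance Definition _ := GRing.Zmodule_isLmodule.Build (ZS n) (polyZS n)
  ZS_actA ZS_act1 ZS_actDr ZS_actDl.

End ZSAction.

Definition multilinear (n : nat) : freeZ1 -> Prop := subgroup_gen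
  (fun f => exists s : 'S_n, f = monom [seq (s i : nat) | i <- enum 'I_n]).

Definition bracket (f g : freeZ1) : freeZ1 := f * g - g * f.

Definition long_comm (f : freeZ1) : Prop :=
  exists i js, js <> [::] /\ f = foldl bracket (var i) (map var js).

Definition comm_prod (f : freeZ1) : Prop :=
  exists cs : seq freeZ1, [/\ cs <> [::],
    forall c, c \in cs -> long_comm c & f = \prod_(c <- cs) c].

Lemma subgroup_gen_morph (V W : zmodType) (S : V -> Prop) (S' : W -> Prop)
    (phi : {additive V -> W}) :
  (forall x, S x -> S' (phi x)) ->
  forall x, subgroup_gen S x -> subgroup_gen S' (phi x).
Proof.
move=> phiS x; elim=> [|y Sy|y z _ IHy _ IHz].
- by rewrite raddf0; constructor.
- by apply: subgroup_genS; apply: phiS.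
- by rewrite raddfB; apply: subgroup_genB.
Qed.

Lemma subgroup_genD (V : zmodType) (S : V -> Prop) x y :
  subgroup_gen S x -> subgroup_gen S y -> subgroup_gen S (x + y).
Proof.
move=> Sx Sy; rewrite -[y]opprK -[- y]sub0r; apply: subgroup_genB => //.
by apply: subgroup_genB => //; constructor.
Qed.

Lemma subgroup_gen_ZS_act n (S : freeZ1 -> Prop) :
  (forall (s : 'S_n) x, S x -> S (perm_vars s x)) ->
  forall (u : ZS n) x, subgroup_gen S x -> subgroup_gen S (ZS_act u x).
Proof.
move=> SP u x Sx; rewrite /ZS_act; elim/big_ind: _ => [||s _].
- by constructor.
- exact: subgroup_genD.
have Sy: subgroup_gen S (perm_vars s x).
  exact: (subgroup_gen_morph (phi := perm_vars s) (SP s)) Sx.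
have SMn k : subgroup_gen S (perm_vars s x *+ k).
  elim: k => [|k IH]; first by rewrite mulr0n; constructor.
  by rewrite mulrS; apply: subgroup_genD.
case: (u s) => k; first exact: SMn.
rewrite NegzE mulrNz -sub0r; apply: subgroup_genB; first by constructor.
exact: SMn.
Qed.

Lemma multilinear_ZS n (u : ZS n) f :
  multilinear n f -> multilinear n (ZS_act u f).
Proof.
apply: subgroup_gen_ZS_act => s _ [t ->]; exists (t * s)%g.
rewrite perm_vars_monom -map_comp; congr monom; apply: eq_map => i /=.
by rewrite /perm_index valK /= permM.
Qed.

Lemma perm_vars_bracket n (s : 'S_n) f g :
  perm_vars s (bracket f g) = bracket (perm_vars s f) (perm_vars s g).
Proof. by rewrite /bracket /perm_vars raddfB; congr (_ - _); apply: pevalM. Qed.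

Lemma long_comm_perm n (s : 'S_n) f : long_comm f -> long_comm (perm_vars s f).
Proof.
case=> i [js [js0 ->]].
exists (perm_index s i), (map (perm_index s) js); split; first by case: js js0.
have vE j : perm_vars s (var j) = var (perm_index s j) by exact: perm_vars_monom.
rewrite -vE; elim: js (var i) {js0} => //= j js IH g.
by rewrite IH perm_vars_bracket vE.
Qed.

Lemma comm_prod_perm n (s : 'S_n) f : comm_prod f -> comm_prod (perm_vars s f).
Proof.
case=> cs [cs0 csP ->]; exists (map (perm_vars s) cs); split.
- by case: cs cs0 {csP}.
- by move=> _ /mapP[c /csP cP ->]; apply: long_comm_perm.
by rewrite big_map /perm_vars rmorph_prod.
Qed.

Definition gamma_pred (n : nat) : {pred polyZS n} :=
  fun f => `[< multilinear n f /\ subgroup_gen comm_prod f >].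

Lemma gamma_closed n : subsemimod_closed (@gamma_pred n).
Proof.
split; first split.
- by apply/asboolP; split; exact: subgroup_gen0.
- move=> f g /asboolP[? ?] /asboolP[? ?]; apply/asboolP.
  by split; apply: subgroup_genD.
- move=> u f /asboolP[? ?]; apply/asboolP; split; first exact: multilinear_ZS.
  exact: (subgroup_gen_ZS_act (@comm_prod_perm n)).
Qed.

Definition gamma (n : nat) : submodule (polyZS n) := Submodule (gamma_closed n).

Lemma in_freeZE f : in_freeZ f <-> peval (fun _ => 0 : int) f = 0.
Proof.
rewrite /in_freeZ; suff -> : f@_(FMonom [::]) = peval (fun _ => 0 : int) f by [].
rewrite {1}[f]freeZ1_expand raddf_sum; apply: eq_bigr => w _.
rewrite raddfMz /= /monom mcoeffU fmK; congr (_ *~ _).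
case: w => [[|i v]]; first by rewrite big_nil eqxx.
by rewrite big_cons mul0r.
Qed.

Section Identities.
Variables (A : pzRingType) (n : nat).

Definition ident_pred : {pred polyZS n} :=
  fun f => `[< in_freeZ f /\ forall a : nat -> A, peval a f = 0 >].

Lemma peval_ZS_act_eq0 (B : pzRingType) (a : nat -> B) (u : ZS n) f :
  (forall s : 'S_n, peval (a \o perm_index s) f = 0) -> peval a (ZS_act u f) = 0.
Proof.
move=> fP; rewrite /ZS_act raddf_sum big1 // => s _.
by rewrite raddfMz /= peval_perm fP mul0rz.
Qed.

Lemma ident_closed : subsemimod_closed ident_pred.
Proof.
split; first split.
- by apply/asboolP; split=> [|a]; rewrite /in_freeZ raddf0.
- move=> f g /asboolP[f0 fP] /asboolP[g0 gP]; apply/asboolP; split=> [|a].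
    by rewrite /in_freeZ raddfD /= f0 g0 addr0.
  by rewrite raddfD /= fP gP addr0.
- move=> u f /asboolP[f0 fP]; apply/asboolP; split=> [|a].
    by apply/in_freeZE/peval_ZS_act_eq0 => s; apply/in_freeZE.
  exact: peval_ZS_act_eq0.
Qed.

Definition ident : submodule (polyZS n) := Submodule ident_closed.

End Identities.

(* The associative unital R-algebra presented by generators e_i (i : nat) and *)
(* relations e_i e_j = - e_j e_i for ALL i, j: algebra terms modulo the least *)
(* congruence containing the algebra axioms and the relations. In particular  *)
(* 2 e_i^2 = 0, but e_i^2 need not vanish when 2 is a zero divisor in R.      *)
Section Grassmann.
Variable R : comPzRingType.

Inductive gterm : Type :=
| GGen of nat | GZero | GOne | GOpp of gterm
| GAdd of gterm & gterm | GMul of gterm & gterm | GScale of R & gterm.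

Inductive gcong : gterm -> gterm -> Prop :=
| gcong_refl x : gcong x x
| gcong_sym x y : gcong x y -> gcong y x
| gcong_trans x y z : gcong x y -> gcong y z -> gcong x z
| gcong_opp x y : gcong x y -> gcong (GOpp x) (GOpp y)
| gcong_add x x' y y' : gcong x x' -> gcong y y' -> gcong (GAdd x y) (GAdd x' y')
| gcong_mul x x' y y' : gcong x x' -> gcong y y' -> gcong (GMul x y) (GMul x' y')
| gcong_scale a x y : gcong x y -> gcong (GScale a x) (GScale a y)
| gcong_addA x y z : gcong (GAdd x (GAdd y z)) (GAdd (GAdd x y) z)
| gcong_addC x y : gcong (GAdd x y) (GAdd y x)
| gcong_add0 x : gcong (GAdd GZero x) x
| gcong_addN x : gcong (GAdd (GOpp x) x) GZero
| gcong_mulA x y z : gcong (GMul x (GMul y z)) (GMul (GMul x y) z)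
| gcong_mul1 x : gcong (GMul GOne x) x
| gcong_mul1r x : gcong (GMul x GOne) x
| gcong_mulDl x y z : gcong (GMul (GAdd x y) z) (GAdd (GMul x z) (GMul y z))
| gcong_mulDr x y z : gcong (GMul x (GAdd y z)) (GAdd (GMul x y) (GMul x z))
| gcong_scaleA a b x : gcong (GScale a (GScale b x)) (GScale (a * b) x)
| gcong_scale1 x : gcong (GScale 1 x) x
| gcong_scaleDr a x y : gcong (GScale a (GAdd x y)) (GAdd (GScale a x) (GScale a y))
| gcong_scaleDl a b x : gcong (GScale (a + b) x) (GAdd (GScale a x) (GScale b x))
| gcong_scaleAl a x y : gcong (GScale a (GMul x y)) (GMul (GScale a x) y)
| gcong_scaleAr a x y : gcong (GScale a (GMul x y)) (GMul x (GScale a y))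
| gcong_anticomm i j : gcong (GMul (GGen i) (GGen j)) (GOpp (GMul (GGen j) (GGen i))).

HB.instance Definition _ := gen_eqMixin gterm.
HB.instance Definition _ := gen_choiceMixin gterm.

Definition gcongb (x y : gterm) : bool := `[< gcong x y >].

Lemma gcongb_equiv : equiv_class_of gcongb.
Proof.
split=> [x|x y|y x z]; first by apply/asboolP; apply: gcong_refl.
- by apply: asbool_equiv_eq; split; apply: gcong_sym.
- by move=> /asboolP xy /asboolP yz; apply/asboolP; apply: gcong_trans xy yz.
Qed.

Canonical gcongb_equiv_rel := EquivRelPack gcongb_equiv.
Canonical gcongb_encModRel := defaultEncModRel gcongb.

Definition grassmann : Type := {eq_quot gcongb}%qT.

HB.instance Definition _ := Choice.on grassmann.

Definition gpi (x : gterm) : grassmann := \pi_({eq_quot gcongb})%qT x.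
Definition grepr (q : grassmann) : gterm := repr (q : {eq_quot gcongb}%qT).

Lemma gpiE x y : gpi x = gpi y <-> gcong x y.
Proof.
split=> [/eqmodP/asboolP // | xy]; by apply/eqmodP/asboolP.
Qed.

Lemma greprK : cancel grepr gpi. Proof. exact: reprK. Qed.

Lemma gpiK x : gcong (grepr (gpi x)) x. Proof. by apply/gpiE; rewrite greprK. Qed.

Definition gzero : grassmann := gpi GZero.
Definition gone : grassmann := gpi GOne.
Definition gopp (p : grassmann) : grassmann := gpi (GOpp (grepr p)).
Definition gadd (p q : grassmann) : grassmann := gpi (GAdd (grepr p) (grepr q)).
Definition gmul (p q : grassmann) : grassmann := gpi (GMul (grepr p) (grepr q)).
Definition gscale (a : R) (p : grassmann) : grassmann := gpi (GScale a (grepr p)).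
Definition ggen (i : nat) : grassmann := gpi (GGen i).

Lemma gopp_pi x : gopp (gpi x) = gpi (GOpp x).
Proof. exact/gpiE/gcong_opp/gpiK. Qed.
Lemma gadd_pi x y : gadd (gpi x) (gpi y) = gpi (GAdd x y).
Proof. by apply/gpiE/gcong_add; apply: gpiK. Qed.
Lemma gmul_pi x y : gmul (gpi x) (gpi y) = gpi (GMul x y).
Proof. by apply/gpiE/gcong_mul; apply: gpiK. Qed.
Lemma gscale_pi a x : gscale a (gpi x) = gpi (GScale a x).
Proof. exact/gpiE/gcong_scale/gpiK. Qed.

Let gE := (gopp_pi, gadd_pi, gmul_pi, gscale_pi).

Lemma gaddA : associative gadd.
Proof.
move=> p q r; rewrite -[p]greprK -[q]greprK -[r]greprK !gE.
exact/gpiE/gcong_addA.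
Qed.
Lemma gaddC : commutative gadd.
Proof. by move=> p q; apply/gpiE/gcong_addC. Qed.
Lemma gadd0 : left_id gzero gadd.
Proof. by move=> p; rewrite -[p]greprK !gE; apply/gpiE/gcong_add0. Qed.
Lemma gaddN : left_inverse gzero gopp gadd.
Proof. by move=> p; rewrite -[p]greprK !gE; apply/gpiE/gcong_addN. Qed.
Lemma gmulA : associative gmul.
Proof.
move=> p q r; rewrite -[p]greprK -[q]greprK -[r]greprK !gE.
exact/gpiE/gcong_mulA.
Qed.
Lemma gmul1 : left_id gone gmul.
Proof. by move=> p; rewrite -[p]greprK !gE; apply/gpiE/gcong_mul1. Qed.
Lemma gmul1r : right_id gone gmul.
Proof. by move=> p; rewrite -[p]greprK !gE; apply/gpiE/gcong_mul1r. Qed.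
Lemma gmulDl : left_distributive gmul gadd.
Proof.
move=> p q r; rewrite -[p]greprK -[q]greprK -[r]greprK !gE.
exact/gpiE/gcong_mulDl.
Qed.
Lemma gmulDr : right_distributive gmul gadd.
Proof.
move=> p q r; rewrite -[p]greprK -[q]greprK -[r]greprK !gE.
exact/gpiE/gcong_mulDr.
Qed.

HB.instance Definition _ := GRing.isPzRing.Build grassmann
  gaddA gaddC gadd0 gaddN gmulA gmul1 gmul1r gmulDl gmulDr.

Lemma gscaleA a b p : gscale a (gscale b p) = gscale (a * b) p.
Proof. by rewrite -[p]greprK !gE; apply/gpiE/gcong_scaleA. Qed.
Lemma gscale1 : left_id 1 gscale.
Proof. by move=> p; rewrite -[p]greprK !gE; apply/gpiE/gcong_scale1. Qed.
Lemma gscaleDr : right_distributive gscale +%R.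
Proof.
move=> a p q; rewrite -![_ + _]/(gadd _ _) -[p]greprK -[q]greprK !gE.
exact/gpiE/gcong_scaleDr.
Qed.
Lemma gscaleDl p : {morph gscale^~ p : a b / a + b}.
Proof.
move=> a b; rewrite -[RHS]/(gadd _ _) -[p]greprK !gE.
exact/gpiE/gcong_scaleDl.
Qed.

HB.instance Definition _ := GRing.Zmodule_isLmodule.Build R grassmann
  gscaleA gscale1 gscaleDr gscaleDl.

(* R may be trivial, in which case so is G_R: hence no [algType R] instance.  *)
Lemma grassmann_scaleAl (a : R) (x y : grassmann) : a *: (x * y) = (a *: x) * y.
Proof.
rewrite -[x]greprK -[y]greprK -![_ *: _]/(gscale _ _) -![_ * _]/(gmul _ _) !gE.
exact/gpiE/gcong_scaleAl.
Qed.

Lemma grassmann_scaleAr (a : R) (x y : grassmann) : a *: (x * y) = x * (a *: y).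
Proof.
rewrite -[x]greprK -[y]greprK -![_ *: _]/(gscale _ _) -![_ * _]/(gmul _ _) !gE.
exact/gpiE/gcong_scaleAr.
Qed.

Lemma ggen_anticomm i j : ggen i * ggen j = - (ggen j * ggen i).
Proof.
rewrite -![_ * _]/(gmul _ _) -[- _]/(gopp _) /ggen !gE; apply/gpiE.
exact: gcong_anticomm.
Qed.

End Grassmann.

(* Main.v *)
Require Import Defs.
From HB Require Import structures.
From mathcomp Require Import all_boot all_order all_algebra all_fingroup.
From mathcomp Require Import boolp monalg zify.

Set Implicit Arguments.
Unset Strict Implicit.
Unset Printing Implicit Defensive.

Import GRing.Theory.

Local Open Scope ring_scope.

(** For anticommuting elements [a_0, ..., a_(n-1)] of any ring, a multilinear
    polynomial [f] takes the value [c(f) a_0 ... a_(n-1)], where [c(f)] is the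
    alternating sum of its coefficients ([peval_anticommuting]). On the
    Grassmann algebra this computes every value of a proper [f]: each element
    is the sum of an even and an odd part, even elements are central, a proper
    polynomial does not see central summands ([peval_proper_shift]), and the
    odd parts anticommute. Since the products [e_0 ... e_(n-1)] are free over
    [R] ([prod_ggen_free]), a proper multilinear [f] is an identity of [G_R]
    exactly when [l] divides [c(f)] ([ident_gamma]).

    Commutators in the Grassmann algebra are central, and therefore so is
    [f(e_0, ..., e_(n-1))] for a proper [f]. For odd [n] it also anticommutes
    with [e_n]; over the integers, which have no 2-torsion, this forces
    [c(f) = 0] ([alt_coef_proper_odd]).

    For [n = 2m] the product of [m] commutators of disjoint pairs of variables
    has [c = 2^m], so [c] maps the proper polynomials onto [dZ] for some
    divisor [d] of [2^m] ([gamma_alt_gen]). Moreover [c] is equivariant for the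
    sign character, and [S(1^n)] is the sign representation [Z b], with [b] the
    alternating sum of all permutations. Hence [f |-> (c(f) / d) b] is a
    surjective homomorphism onto [S(1^n)]. As [d] is prime to an odd [l], and
    nonzero when [l = 0], the identities are exactly the polynomials that land
    in [l S(1^n)]. *)

(** * Anticommuting families and the alternating coefficient *)

Definition anticommuting (A : pzRingType) (n : nat) (a : nat -> A) : Prop :=
  forall i j : 'I_n, i != j -> a i * a j = - (a j * a i).

Lemma mul_prod_anticommuting (A : pzRingType) (x : A) (r : seq A) :
  (forall y, y \in r -> x * y = - (y * x)) ->
  x * \prod_(y <- r) y = (-1) ^+ size r * (\prod_(y <- r) y * x).
Proof.
elim: r => [|z r IH] xr; first by rewrite big_nil mulr1 !mul1r.
rewrite big_cons mulrA xr ?mem_head // mulNr -(mulrA z) IH; last first.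
  by move=> y yr; rewrite xr // inE yr orbT.
by rewrite mulrA commr_sign -!mulrA /= exprS mulN1r mulNr.
Qed.

(** Moving two entries past the block between them costs the same sign twice,
    so only the sign of exchanging these two entries is left. *)
Lemma prod_swap (A : pzRingType) (x y : A) (u v w : seq A) :
  x * y = - (y * x) ->
  (forall z, z \in v -> x * z = - (z * x)) ->
  (forall z, z \in v -> y * z = - (z * y)) ->
  \prod_(z <- u ++ x :: v ++ y :: w) z =
    - \prod_(z <- u ++ y :: v ++ x :: w) z.
Proof.
move=> xy xv yv; rewrite !(big_cat, big_cons) /= -mulrN; congr (_ * _).
rewrite mulrA [in RHS]mulrA !(mul_prod_anticommuting (r := v)) //.
by rewrite -!mulrA (mulrA x) xy mulNr !mulrN !mulrA.
Qed.

(** The two exchanged indices split the enumeration into the blocks of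
    [prod_swap], and the other entries are left in place. *)
Lemma prod_tperm (A : pzRingType) (n : nat) (b : 'I_n -> A) (i j : 'I_n) :
  (forall k l, k != l -> b k * b l = - (b l * b k)) -> i != j ->
  \prod_(k <- enum 'I_n) b (tperm i j k) = - \prod_(k <- enum 'I_n) b k.
Proof.
move=> bb; wlog lt_ij : i j / (index i (enum 'I_n) < index j (enum 'I_n))%N.
  move=> IH ij; have := ij.
  case: (ltngtP (index i (enum 'I_n)) (index j (enum 'I_n))).
  - by move=> /IH.
  - by rewrite tpermC eq_sym => /IH.
  - by move=> /index_inj ->; rewrite ?mem_enum ?eqxx.
move=> ij; have := enum_uniq 'I_n; move: lt_ij.
have: i \in enum 'I_n by rewrite mem_enum.
have: j \in enum 'I_n by rewrite mem_enum.
case/splitPr=> u0 w; rewrite mem_cat inE (negbTE ij) /=.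
case iu: (i \in u0); last first.
  case ju: (j \in u0); first by rewrite cat_uniq /= ju !(andbF, orbF).
  move=> _; rewrite !index_cat iu ju /= eqxx; case: ifP; lia.
move=> _ _; case/splitPr: iu => u v.
rewrite -catA /= cat_uniq /= => /and3P[_].
rewrite negb_or => /andP[iNu]; rewrite has_cat /= !negb_or => /and3P[_ jNu _].
rewrite mem_cat inE !negb_or cat_uniq /= => /and3P[/and3P[iNv _ iNw] _].
move=> /and3P[]; rewrite negb_or => /andP[jNv wNv] jNw _.
have fixE s : i \notin s -> j \notin s ->
    [seq b (tperm i j k) | k <- s] = [seq b k | k <- s].
  move=> iNs jNs; apply/eq_in_map => k ks.
  by rewrite tpermD //; [apply: contraNneq iNs | apply: contraNneq jNs] => ->.
have mapE (F : 'I_n -> A) s :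
    \prod_(k <- s) F k = \prod_(z <- [seq F k | k <- s]) z by rewrite big_map.
rewrite !mapE !(map_cat, map_cons).
rewrite tpermL tpermR !fixE // prod_swap //.
- by apply: bb; rewrite eq_sym.
- by move=> _ /mapP[k kv ->]; apply: bb; apply: contraNneq jNv => ->.
- by move=> _ /mapP[k kv ->]; apply: bb; apply: contraNneq iNv => ->.
Qed.

(** Both sides change sign under a transposition, and transpositions generate
    the symmetric group. *)
Lemma prod_anticommuting_perm (A : pzRingType) (n : nat) (a : nat -> A)
    (s : 'S_n) : anticommuting n a ->
  \prod_(k <- enum 'I_n) a (s k) = (-1) ^+ s * \prod_(k <- enum 'I_n) a k.
Proof.
move=> aa; have [ts -> {s}] := prod_tpermP s.
elim: ts => [|[i j] ts IH] /=; first rewrite big_nil odd_perm1 mul1r.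
  by move=> _; apply: eq_bigr => k _; rewrite perm1.
rewrite big_cons /= => /andP[ij /IH {IH}].
set s := (\prod_(t <- ts) _)%g => IH.
rewrite odd_mul_tperm ij addTb signrN mulNr -IH.
under eq_bigr => k _ do rewrite permM.
rewrite (prod_tperm (b := fun k => a (s k))) // => k k' kk'.
by apply: aa; rewrite (inj_eq perm_inj).
Qed.

Definition perm_word (n : nat) (s : 'S_n) : seq nat :=
  [seq (s i : nat) | i <- enum 'I_n].

Lemma perm_word_inj n : injective (@perm_word n).
Proof.
move=> s t /eq_in_map st; apply/permP => i.
by apply: val_inj; apply: st; rewrite mem_enum.
Qed.

(** The factor by which a multilinear polynomial of degree [n] multiplies the
    product of an anticommuting family. *)
Definition alt_coef (n : nat) (f : freeZ1) : int :=
  \sum_(s : 'S_n) (-1) ^+ odd_perm s * f@_(FMonom (perm_word s)).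

Lemma alt_coef_is_zmod_morphism n : zmod_morphism (alt_coef n).
Proof.
move=> f g; rewrite /alt_coef -sumrB; apply: eq_bigr => s _.
by rewrite mcoeffB mulrBr.
Qed.

HB.instance Definition _ n :=
  GRing.isZmodMorphism.Build freeZ1 int (alt_coef n)
    (alt_coef_is_zmod_morphism n).

Lemma alt_coef_monom n (s : 'S_n) :
  alt_coef n (monom (perm_word s)) = (-1) ^+ odd_perm s.
Proof.
rewrite /alt_coef (bigD1 s) //= mcoeffUU mulr1 big1 ?addr0 // => t ts.
rewrite mcoeffU (_ : _ == _ = false) ?mulr0 //.
apply/negP => /eqP [] /perm_word_inj st.
by rewrite st eqxx in ts.
Qed.

Lemma peval_anticommuting (A : pzRingType) (n : nat) (a : nat -> A) f :
  anticommuting n a -> multilinear n f ->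
  peval a f = (\prod_(k <- enum 'I_n) a k) *~ alt_coef n f.
Proof.
move=> aa; elim=> [|_ [s ->]|g h _ IHg _ IHh].
- by rewrite !raddf0.
- rewrite alt_coef_monom peval_monom big_map prod_anticommuting_perm //.
  by case: (odd_perm s); rewrite ?mul1r // expr1 mulN1r.
- by rewrite raddfB [alt_coef n _]raddfB /= IHg IHh mulrzBr.
Qed.

Definition sign_char (n : nat) (u : ZS n) : int :=
  \sum_(s : 'S_n) u s * (-1) ^+ odd_perm s.

Lemma alt_coef_perm_vars n (s : 'S_n) f : multilinear n f ->
  alt_coef n (perm_vars s f) = (-1) ^+ odd_perm s * alt_coef n f.
Proof.
elim=> [|_ [t ->]|g h _ IHg _ IHh].
- by rewrite !raddf0 mulr0.
- rewrite perm_vars_monom -map_comp.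
  have -> : [seq (perm_index s \o (fun i => t i : nat)) i | i <- enum 'I_n] =
      perm_word (t * s)%g.
    by apply: eq_map => i /=; rewrite /perm_index valK /= permM.
  by rewrite !alt_coef_monom odd_permM addbC signr_addb.
- by rewrite raddfB ![alt_coef n _]raddfB /= IHg IHh mulrBr.
Qed.

Lemma alt_coef_ZS_act n (u : ZS n) f : multilinear n f ->
  alt_coef n (ZS_act u f) = sign_char u * alt_coef n f.
Proof.
move=> fM; rewrite /ZS_act raddf_sum mulr_suml; apply: eq_bigr => s _.
by rewrite raddfMz /= alt_coef_perm_vars // -mulrzl intz mulrA.
Qed.

(** * Values of proper polynomials *)

Definition central (A : pzRingType) (x : A) : Prop := forall y, GRing.comm x y.

Lemma commutator_centralDr (A : pzRingType) (x y z : A) :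
  central z -> x * (y + z) - (y + z) * x = x * y - y * x.
Proof. by move=> zC; rewrite mulrDr mulrDl (zC x) opprD addrACA subrr addr0. Qed.

Lemma commutator_centralDl (A : pzRingType) (x y z : A) :
  central z -> (x + z) * y - y * (x + z) = x * y - y * x.
Proof. by move=> zC; rewrite -opprB commutator_centralDr // opprB. Qed.

Definition proper_poly : freeZ1 -> Prop := subgroup_gen comm_prod.

Lemma peval_bracket (A : pzRingType) (a : nat -> A) f g :
  peval a (bracket f g) = peval a f * peval a g - peval a g * peval a f.
Proof. by rewrite /bracket raddfB /= !pevalM. Qed.

(** A long commutator is the commutator of some element with a variable, so it
    is central as soon as all commutators are. *)
Lemma peval_proper_central (A : pzRingType) (a : nat -> A) f :
  (forall x y : A, central (x * y - y * x)) ->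
  proper_poly f -> central (peval a f).
Proof.
move=> commC; elim=> [y|_ [cs [_ csP ->]] y|g h _ IHg _ IHh y].
- by rewrite raddf0; apply/commr_sym/commr0.
- rewrite rmorph_prod big_seq; apply/commr_sym/commr_prod => c /csP.
  case=> i [js [js0 ->]]; case/lastP: js js0 => // js j _.
  by rewrite /= map_rcons foldl_rcons peval_bracket; apply/commr_sym/commC.
- rewrite raddfB; apply/commr_sym/commrB; apply/commr_sym; first exact: IHg.
  exact: IHh.
Qed.

Lemma peval_proper_shift (A : pzRingType) (a z : nat -> A) f :
  (forall i, central (z i)) -> proper_poly f ->
  peval (fun i => a i + z i) f = peval a f.
Proof.
move=> zC; elim=> [|_ [cs [_ csP ->]]|g h _ IHg _ IHh].
- by rewrite !raddf0.
- rewrite !rmorph_prod; apply: eq_big_seq => c /csP [i [js [js0 ->]]] /=.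
  elim/last_ind: js js0 => // js j IH _.
  rewrite map_rcons foldl_rcons !peval_bracket !peval_var.
  rewrite commutator_centralDr //; case: js IH => [|k js] IH; last by rewrite IH.
  by rewrite /= !peval_var commutator_centralDl.
- by rewrite !raddfB /= IHg IHh.
Qed.

(** * The Grassmann algebra *)

(** The subsets of the set of generators are encoded by their characteristic
    functions. *)
Definition remove (i : nat) (S : nat -> bool) : nat -> bool :=
  fun j => (j != i) && S j.

Definition below (i : nat) (S : nat -> bool) : nat := (\sum_(j < i) S j)%N.

Lemma removeC i j (S : nat -> bool) :
  remove i (remove j S) = remove j (remove i S).
Proof. by apply: funext => k; rewrite /remove andbCA. Qed.

Lemma below_remove_ge i j (S : nat -> bool) :
  (j <= i)%N -> below j (remove i S) = below j S.
Proof.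
move=> ji; apply: eq_bigr => k _; rewrite /remove neq_ltn.
by rewrite (leq_trans (ltn_ord k) ji).
Qed.

Lemma below_remove_lt i j (S : nat -> bool) : (i < j)%N -> S i ->
  below j S = (below j (remove i S)).+1.
Proof.
move=> ij Si; rewrite /below (bigD1 (Ordinal ij)) //= Si.
rewrite [in RHS](bigD1 (Ordinal ij)) //= /remove eqxx add0n add1n.
by congr _.+1; apply: eq_bigr => k; rewrite -val_eqE /= => ->.
Qed.

(** A model of the relations that keeps the products of distinct generators
    free over [R]: left multiplication in the exterior algebra. With an element
    written as the function of its coordinates on the ordered monomials [e_S],
    the coordinate of [e_i v] at [S] comes from that of [v] at [S] minus [i],
    with the sign of moving [e_i] past the smaller generators. *)
Fixpoint gact (R : comPzRingType) (t : gterm R) (v : (nat -> bool) -> R) :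
    (nat -> bool) -> R :=
  match t with
  | GGen i => fun S => if S i then (-1) ^+ below i S * v (remove i S) else 0
  | GZero => fun _ => 0
  | GOne => v
  | GOpp x => fun S => - gact x v S
  | GAdd x y => fun S => gact x v S + gact y v S
  | GMul x y => gact x (gact y v)
  | GScale a x => fun S => a * gact x v S
  end.

Lemma gactD (R : comPzRingType) (t : gterm R) v w :
  gact t (fun S => v S + w S) = fun S => gact t v S + gact t w S.
Proof.
elim: t v w => [i|||x IH|x IHx y IHy|x IHx y IHy|a x IH] v w /=;
  apply/funext => S //.
- by case: (S i); rewrite ?addr0 // mulrDr.
- by rewrite addr0.
- by rewrite IH opprD.
- by rewrite IHx IHy addrACA.
- by rewrite IHy IHx.
- by rewrite IH mulrDr.
Qed.

Lemma gactZ (R : comPzRingType) (t : gterm R) c v :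
  gact t (fun S => c * v S) = fun S => c * gact t v S.
Proof.
elim: t v => [i|||x IH|x IHx y IHy|x IHx y IHy|a x IH] v /=;
  apply/funext => S //.
- by case: (S i); rewrite ?mulr0 // mulrCA.
- by rewrite mulr0.
- by rewrite IH mulrN.
- by rewrite IHx IHy mulrDr.
- by rewrite IHy IHx.
- by rewrite IH mulrCA.
Qed.

Lemma gact_anticomm (R : comPzRingType) (i j : nat) (v : (nat -> bool) -> R) S :
  gact (GMul (GGen R i) (GGen R j)) v S =
    - gact (GMul (GGen R j) (GGen R i)) v S.
Proof.
wlog ij : i j / (i <= j)%N.
  by move=> IH; case: (leqP i j) => [/IH // | /ltnW /IH ->]; rewrite opprK.
move: ij; rewrite leq_eqVlt => /predU1P[-> /=|ij /=].
  by case: (S j); rewrite /remove ?eqxx ?mulr0 oppr0.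
have -> : remove i S j = S j by rewrite /remove gtn_eqF.
have -> : remove j S i = S i by rewrite /remove ltn_eqF.
case Si: (S i); case Sj: (S j); rewrite ?mulr0 ?oppr0 //.
rewrite (below_remove_lt ij Si) (below_remove_ge _ (ltnW ij)) removeC.
by rewrite exprS mulN1r mulNr opprK mulrCA.
Qed.

Lemma gact_cong (R : comPzRingType) (x y : gterm R) :
  gcong x y -> gact x = gact y.
Proof.
elim=> {x y} //=.
- by move=> x y z _ -> _ ->.
- by move=> x y _ ->.
- by move=> x x' y y' _ -> _ ->.
- by move=> x x' y y' _ -> _ ->.
- by move=> a x y _ ->.
- by move=> x y z; apply/funext => v; apply/funext => S; rewrite addrA.
- by move=> x y; apply/funext => v; apply/funext => S; rewrite addrC.
- by move=> x; apply/funext => v; apply/funext => S; rewrite add0r.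
- by move=> x; apply/funext => v; apply/funext => S; rewrite addNr.
- by move=> x y z; apply/funext => v; rewrite gactD.
- by move=> a b x; apply/funext => v; apply/funext => S; rewrite mulrA.
- by move=> x; apply/funext => v; apply/funext => S; rewrite mul1r.
- by move=> a x y; apply/funext => v; apply/funext => S; rewrite mulrDr.
- by move=> a b x; apply/funext => v; apply/funext => S; rewrite mulrDl.
- by move=> a x y; apply/funext => v; rewrite gactZ.
- by move=> i j; apply/funext => v; apply/funext => S; apply: gact_anticomm.
Qed.

Definition grassmann_act (R : comPzRingType) (x : grassmann R) :=
  gact (grepr x).

Lemma grassmann_act_pi (R : comPzRingType) (t : gterm R) :
  grassmann_act (gpi t) = gact t.
Proof. exact/gact_cong/gpiK. Qed.

Lemma grassmann_act1 (R : comPzRingType) v : grassmann_act (1 : grassmann R) v = v.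
Proof. by rewrite (grassmann_act_pi (GOne R)). Qed.

Lemma grassmann_actM (R : comPzRingType) (x y : grassmann R) v :
  grassmann_act (x * y) v = grassmann_act x (grassmann_act y v).
Proof. by rewrite (grassmann_act_pi (GMul (grepr x) (grepr y))). Qed.

Lemma grassmann_actB (R : comPzRingType) (x y : grassmann R) v S :
  grassmann_act (x - y) v S = grassmann_act x v S - grassmann_act y v S.
Proof.
rewrite (grassmann_act_pi (GAdd (grepr x) (grepr (- y)))) /= -!/(grassmann_act _).
by rewrite (grassmann_act_pi (GOpp (grepr y))).
Qed.

Definition gcoord (R : comPzRingType) v S (x : grassmann R) : R :=
  grassmann_act x v S.

Lemma gcoord_is_zmod_morphism (R : comPzRingType) v S :
  zmod_morphism (@gcoord R v S).
Proof.
by move=> x y; apply: grassmann_actB.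
Qed.

HB.instance Definition _ (R : comPzRingType) v S :=
  GRing.isZmodMorphism.Build (grassmann R) R (gcoord v S)
    (gcoord_is_zmod_morphism v S).

(** At each step the generator that acts has the smallest index of the set, so
    no sign appears; after the last step the constant function 1 is evaluated
    at the empty set. *)
Lemma gcoord_prod_ggen (R : comPzRingType) i j :
  gcoord (fun _ => 1) (fun k => (i <= k < i + j)%N)
    (\prod_(k <- iota i j) ggen R k) = 1.
Proof.
rewrite /gcoord; elim: j i => [|j IH] i.
  by rewrite big_nil grassmann_act1.
rewrite /= big_cons grassmann_actM grassmann_act_pi /= leqnn -{1}[i]addn0 ltn_add2l /=.
rewrite /below big1 => [|k _]; last by rewrite leqNgt ltn_ord.
rewrite mul1r -[RHS](IH i.+1); congr grassmann_act.
by apply/funext => k; rewrite /remove; lia.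
Qed.

Lemma prod_ggen_free (R : comPzRingType) n (c : int) :
  (\prod_(k <- iota 0 n) ggen R k) *~ c = 0 -> c%:~R = 0 :> R.
Proof.
move=> /(congr1 (gcoord (fun _ => 1) (fun k => (0 <= k < 0 + n)%N))).
by rewrite raddfMz raddf0; have /= -> := gcoord_prod_ggen R 0 n.
Qed.

Lemma prod_enum_ord (A : pzRingType) n (a : nat -> A) :
  \prod_(k <- enum 'I_n) a k = \prod_(k <- iota 0 n) a k.
Proof. by rewrite -val_enum_ord big_map. Qed.

Lemma ggen_anticommuting (R : comPzRingType) n : anticommuting n (ggen R).
Proof. by move=> i j _; apply: ggen_anticomm. Qed.

(** Homogeneity for the grading by parity: the elements of parity [true] are
    the odd ones. *)
Inductive homogeneous (R : comPzRingType) : bool -> grassmann R -> Prop :=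
| hom_gen i : homogeneous true (ggen R i)
| hom0 b : homogeneous b 0
| hom1 : homogeneous false 1
| homN b x of homogeneous b x : homogeneous b (- x)
| homD b x y of homogeneous b x & homogeneous b y : homogeneous b (x + y)
| homM b c x y of homogeneous b x & homogeneous c y :
    homogeneous (b (+) c) (x * y)
| homZ b r x of homogeneous b x : homogeneous b (r *: x).

Lemma homogeneous_decomp (R : comPzRingType) (x : grassmann R) :
  exists y z, [/\ homogeneous false y, homogeneous true z & x = y + z].
Proof.
rewrite -[x]greprK; elim: (grepr x) => [i|||t|t IHt u IHu|t IHt u IHu|r t].
- by exists 0, (ggen R i); rewrite add0r; split=> //; constructor.
- by exists 0, 0; rewrite addr0; split=> //; constructor.
- by exists 1, 0; rewrite addr0; split=> //; constructor.
- case=> y [z [hy hz E]]; exists (- y), (- z).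
  by split; [exact: homN | exact: homN | rewrite -opprD -E -gopp_pi].
- case: IHt IHu => [y [z [hy hz Et]]] [y' [z' [hy' hz' Eu]]].
  exists (y + y'), (z + z'); split; [exact: homD | exact: homD |].
  by rewrite addrACA -Et -Eu -gadd_pi.
- case: IHt IHu => [y [z [hy hz Et]]] [y' [z' [hy' hz' Eu]]].
  exists (y * y' + z * z'), (y * z' + z * y'); split.
  + exact: homD (homM hy hy') (homM hz hz').
  + exact: homD (homM hy hz') (homM hz hy').
  + rewrite -gmul_pi Et Eu -[LHS]/((y + z) * (y' + z')) mulrDl !mulrDr.
    by rewrite [z * y' + _]addrC addrACA.
- case=> y [z [hy hz E]]; exists (r *: y), (r *: z).
  by split; [exact: homZ | exact: homZ | rewrite -scalerDr -E -gscale_pi].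
Qed.

(** The sign rule of a supercommutative algebra: it holds for the generators by
    definition, and it passes to products and linear combinations. *)
Lemma homogeneous_comm (R : comPzRingType) b c (x y : grassmann R) :
  homogeneous b x -> homogeneous c y -> x * y = (-1) ^+ (b && c) * (y * x).
Proof.
move=> hx; elim: hx c y => {b x} [i|b||b x _ IH|b x x' _ IHx _ IHx'
    |b b' x x' _ IHx _ IHx'|b r x _ IH] c y hy.
- elim: hy => {c y} [j|c||c y _ IH|c y y' _ IHy _ IHy'
      |c c' y y' _ IHy _ IHy'|c r y _ IH] /=.
  + by rewrite expr1 mulN1r; apply: ggen_anticomm.
  + by rewrite mulr0 mul0r mulr0.
  + by rewrite mulr1 !mul1r.
  + by rewrite mulrN mulNr mulrN IH.
  + by rewrite mulrDr mulrDl mulrDr IHy IHy'.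
  + rewrite mulrA IHy -!mulrA IHy' /= signr_addb.
    by rewrite (mulrA y (_ ^+ _)) (commr_sign y) -!mulrA.
  + by rewrite -grassmann_scaleAr IH -grassmann_scaleAl -grassmann_scaleAr.
- by rewrite mulr0 mul0r mulr0.
- by rewrite mulr1 !mul1r.
- by rewrite mulrN mulNr mulrN (IH c).
- by rewrite mulrDr mulrDl mulrDr (IHx c) ?(IHx' c).
- rewrite -mulrA (IHx' c) // (mulrA x (_ ^+ _)) (commr_sign x) -!mulrA (mulrA x) (IHx c) //.
  by rewrite andb_addl addbC signr_addb -!mulrA.
- by rewrite -grassmann_scaleAr -grassmann_scaleAl (IH c) // -grassmann_scaleAr.
Qed.

Lemma even_central (R : comPzRingType) (x : grassmann R) :
  homogeneous false x -> central x.
Proof.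
move=> hx y; have [z [t [hz ht ->]]] := homogeneous_decomp y.
apply: commrD; rewrite /GRing.comm.
  by rewrite (homogeneous_comm hx hz) mul1r.
by rewrite (homogeneous_comm hx ht) mul1r.
Qed.

(** Even parts are central, so only the odd parts [u] and [v] contribute to a
    commutator, and [uv - vu] is even. *)
Lemma grassmann_commutator_central (R : comPzRingType) (x y : grassmann R) :
  central (x * y - y * x).
Proof.
have [x0 [u [hx hu ->]]] := homogeneous_decomp x.
have [y0 [v [hy hv ->]]] := homogeneous_decomp y.
have -> : (x0 + u) * (y0 + v) - (y0 + v) * (x0 + u) = u * v - v * u.
  rewrite [x0 + u]addrC [y0 + v]addrC.
  rewrite (commutator_centralDr (u + x0) v (even_central hy)).
  exact: (commutator_centralDl u v (even_central hx)).
apply/even_central/homD; first exact: (homM hu hv).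
exact: homN (homM hv hu).
Qed.

(** * Proper polynomials on the Grassmann algebra *)

Lemma has_char_int (R : pzRingType) l (k : int) :
  has_char R l -> k%:~R = 0 :> R <-> (l %| k)%Z.
Proof.
have absz0 : `|k|%N%:R = 0 :> R <-> k%:~R = 0 :> R.
  case: k => n //; rewrite NegzE abszN mulrNz.
  split=> [n0|/eqP]; last by rewrite oppr_eq0 => /eqP.
  by apply/eqP; rewrite oppr_eq0; apply/eqP.
move=> charR; rewrite -absz0 dvdzE /=; case: charR => [[l0 lR lmin]|[-> lmin]].
  rewrite (divn_eq `|k|%N l) natrD natrM lR mulr0 add0r /dvdn modnMDl modn_mod.
  split=> [r0|/eqP ->] //; apply: contraT; rewrite -lt0n => /lmin/(_ r0).
  by rewrite leqNgt ltn_pmod.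
rewrite dvd0n; split=> [k0|/eqP -> //].
by apply: contraT; rewrite -lt0n => /lmin; rewrite k0.
Qed.

(** The witness is the product of the odd parts of the [a_i]: the even parts
    are central and may be dropped. *)
Lemma peval_proper_grassmann (R : comPzRingType) n f (a : nat -> grassmann R) :
  multilinear n f -> proper_poly f ->
  exists x, peval a f = x *~ alt_coef n f.
Proof.
move=> fM fP; have [z zP] := boolp.choice (fun i => homogeneous_decomp (a i)).
have [u uP] := boolp.choice zP.
rewrite (eq_peval (b := fun i => u i + z i)); last first.
  by move=> i; have [_ _ ->] := uP i; rewrite addrC.
rewrite peval_proper_shift //; last first.
  by move=> i; apply: even_central; have [] := uP i.
exists (\prod_(k <- enum 'I_n) u k); apply: peval_anticommuting => // i j _.
have [_ hi _] := uP i; have [_ hj _] := uP j.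
by rewrite (homogeneous_comm hi hj) expr1 mulN1r.
Qed.

Lemma peval_ggen_multilinear (R : comPzRingType) n f : multilinear n f ->
  peval (ggen R) f = (\prod_(k <- iota 0 n) ggen R k) *~ alt_coef n f.
Proof.
move=> fM; rewrite (peval_anticommuting (@ggen_anticommuting R n) fM).
by rewrite prod_enum_ord.
Qed.

Lemma gammaP n (f : polyZS n) :
  reflect (multilinear n f /\ proper_poly f) (f \in gamma n).
Proof. exact: asboolP. Qed.

(** The generators decide: their product is free over [R], and the values at
    all other elements are multiples of [c(f)] as well. *)
Lemma ident_gamma (R : comPzRingType) l n (f : polyZS n) :
  has_char R l -> (0 < n)%N -> f \in gamma n ->
  f \in ident (grassmann R) n <-> (l %| alt_coef n f)%Z.
Proof.
move=> charR n0 /gammaP[fM fP]; split=> [/asboolP[_ fI]|dvd_l].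
  apply/(has_char_int _ charR)/(@prod_ggen_free R n).
  by rewrite -(peval_ggen_multilinear _ fM) fI.
apply/asboolP; split=> [|a].
  (* The constant term is the value at zero, again an anticommuting family. *)
  apply/in_freeZE; rewrite (@peval_anticommuting _ n) //.
  have -> : \prod_(k <- enum 'I_n) (0 : int) = 0; last by rewrite mul0rz.
  by case: (n) n0 => // k _; rewrite enum_ordSl big_cons mul0r.
have [x ->] := peval_proper_grassmann a fM fP.
by rewrite -scaler_int; move/(has_char_int _ charR): dvd_l => ->; rewrite scale0r.
Qed.

(** The value of [f] at the generators is central, so it commutes with one more
    generator; but moving that generator past an odd number of others changes
    the sign. *)
Lemma alt_coef_proper_odd n f :
  odd n -> multilinear n f -> proper_poly f -> alt_coef n f = 0.
Proof.
move=> n_odd fM fP.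
have := peval_proper_central (ggen int) (@grassmann_commutator_central _) fP.
rewrite (peval_ggen_multilinear _ fM); set c := alt_coef n f => /(_ (ggen int n)).
set p := \prod_(k <- _) _; rewrite /GRing.comm mulrzAl mulrzAr.
have -> : ggen int n * p = - (p * ggen int n).
  have pE : p = \prod_(y <- map (ggen int) (iota 0 n)) y by rewrite big_map.
  rewrite pE mul_prod_anticommuting => [|y /mapP[k _ ->]].
    by rewrite size_map size_iota -signr_odd n_odd expr1 mulN1r.
  exact: ggen_anticomm.
rewrite mulNrz => /eqP; rewrite -addr_eq0 -mulrzDr => /eqP.
have -> : p * ggen int n = \prod_(k <- iota 0 n.+1) ggen int k.
  by rewrite -addn1 iotaD big_cat big_seq1.
by move=> /prod_ggen_free; rewrite intz; lia.
Qed.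

(** * Values of the alternating coefficient *)

Definition comm_pairs (m : nat) : freeZ1 :=
  \prod_(i <- iota 0 m) bracket (var i.*2) (var i.*2.+1).

Lemma comm_pairsS m :
  comm_pairs m.+1 = comm_pairs m * bracket (var m.*2) (var m.*2.+1).
Proof. by rewrite /comm_pairs -addn1 iotaD big_cat big_seq1. Qed.

Lemma monomM v w : monom v * monom w = monom (v ++ w).
Proof. by rewrite -!prod_var big_cat. Qed.

Lemma perm_wordP n w :
  perm_eq w (iota 0 n) -> exists s : 'S_n, w = perm_word s.
Proof.
move=> /(@tuple_permP _ n w (iota_tuple n 0))[s ->]; exists s.
rewrite /perm_word; apply: eq_map => i.
by rewrite (tnth_nth 0%N) nth_iota // add0n.
Qed.

Definition rearrangement n (f : freeZ1) : Prop :=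
  exists2 w, perm_eq w (iota 0 n) & f = monom w.

Lemma multilinear_comm_pairs m : multilinear (2 * m) (comm_pairs m).
Proof.
suff: subgroup_gen (rearrangement m.*2) (comm_pairs m).
  rewrite mul2n; elim=> [|_ [w /perm_wordP[s ->] ->]|x y _ IHx _ IHy].
  - exact: subgroup_gen0.
  - by apply: subgroup_genS; exists s.
  - exact: subgroup_genB.
elim: m => [|m IH].
  by apply: subgroup_genS; exists [::]; rewrite // /comm_pairs big_nil -prod_var big_nil.
have step v : perm_eq v [:: m.*2; m.*2.+1] -> forall f,
    subgroup_gen (rearrangement m.*2) f ->
    subgroup_gen (rearrangement m.+1.*2) (f * monom v).
  move=> vP f; elim=> [|_ [w wP ->]|x y _ IHx _ IHy].
  - by rewrite mul0r; apply: subgroup_gen0.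
  - apply: subgroup_genS; exists (w ++ v); last by rewrite monomM.
    by rewrite doubleS -addn2 iotaD perm_cat.
  - by rewrite mulrBl; apply: subgroup_genB.
rewrite comm_pairsS /bracket /var !monomM mulrBr.
by apply: subgroup_genB; apply: step => //; rewrite (perm_catC [:: _] [:: _]).
Qed.

Lemma comm_pairs_gamma m : (0 < m)%N -> comm_pairs m \in gamma (2 * m).
Proof.
move=> m0; apply/gammaP; split; first exact: multilinear_comm_pairs.
apply: subgroup_genS; exists [seq bracket (var i.*2) (var i.*2.+1) | i <- iota 0 m].
split; [by case: m m0 | | by rewrite big_map].
by move=> _ /mapP[i _ ->]; exists i.*2, [:: i.*2.+1].
Qed.

(** Read off from the value at the generators, where the commutator of [e_(2i)]
    and [e_(2i+1)] is [2 e_(2i) e_(2i+1)]. *)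
Lemma alt_coef_comm_pairs m : alt_coef (2 * m) (comm_pairs m) = (2 ^ m)%N.
Proof.
have E : peval (ggen int) (comm_pairs m) =
    (\prod_(k <- iota 0 (2 * m)) ggen int k) *+ (2 ^ m).
  rewrite mul2n; elim: m => [|m IH].
    by rewrite /comm_pairs !big_nil rmorph1.
  rewrite comm_pairsS pevalM IH peval_bracket !peval_var.
  rewrite (ggen_anticomm int m.*2.+1) opprK -mulr2n mulrnAr mulrnAl -mulrnA expnS.
  by rewrite mulnC doubleS -[in RHS]addn2 iotaD big_cat /= !big_cons big_nil mulr1.
have := peval_ggen_multilinear int (multilinear_comm_pairs m).
rewrite E pmulrn => /eqP; rewrite eq_sym -subr_eq0 -mulrzBr => /eqP/prod_ggen_free.
by rewrite intz => /eqP; rewrite subr_eq0 => /eqP.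
Qed.

Definition gamma_alt n (f : submod (gamma n)) : int := alt_coef n (val f).

Lemma gamma_alt_is_zmod_morphism n : zmod_morphism (@gamma_alt n).
Proof. by move=> f g; rewrite -[RHS](raddfB (alt_coef n)). Qed.

HB.instance Definition _ n :=
  GRing.isZmodMorphism.Build (submod (gamma n)) int (@gamma_alt n)
    (@gamma_alt_is_zmod_morphism n).

(** The values of [c] form an ideal of [Z] that contains [2^m], so its least
    positive element [d] generates it and divides [2^m]. *)
Lemma gamma_alt_gen m : (0 < m)%N ->
  exists2 d : nat, (d %| 2 ^ m)%N &
    (exists f0 : submod (gamma (2 * m)), gamma_alt f0 = d) /\
    (forall f : submod (gamma (2 * m)), (d %| gamma_alt f)%Z).
Proof.
move=> m0; set n := (2 * m)%N.
pose f2 : submod (gamma n) := Submod (comm_pairs_gamma m0).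
have f2E : gamma_alt f2 = (2 ^ m)%N by apply: alt_coef_comm_pairs.
pose P k := (0 < k)%N && `[< exists f : submod (gamma n), gamma_alt f = k >].
have P2 : exists k, P k.
  by exists (2 ^ m)%N; rewrite /P expn_gt0 /=; apply/asboolP; exists f2.
case: (ex_minnP P2) => d /andP[d0 /asboolP[f0 f0d]] dmin {P2}.
have dvd_d (f : submod (gamma n)) : (d %| gamma_alt f)%Z.
  apply/dvdz_mod0P; set c := gamma_alt f.
  have dz : d%:Z != 0 by lia.
  have := ltz_mod c dz; have := modz_ge0 c dz.
  case r0 : ((c %% d)%Z) => [[|r]|] // _ ltr.
  (* A nonzero remainder would be a smaller positive value of c. *)
  suff /dmin : P r.+1 by lia.
  apply/asboolP; exists (f - f0 *~ (c %/ d)%Z).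
  rewrite raddfB raddfMz /= f0d -/c -r0 {1}(divz_eq c d) mulrzz mulrC.
  by rewrite addrAC subrr add0r.
exists d; last by split; first by exists f0.
by have := dvd_d f2; rewrite f2E dvdzE.
Qed.

(** * Isomorphisms of subquotients *)

Lemma mod_isomorphic_subquot (A : pzRingType) (M M' : lmodType A)
    (U N : submodule M) (U' N' : submodule M') (g : submod U -> submod U') :
  linear g -> (forall y, exists x, g x = y) ->
  (forall x, val x \in N <-> val (g x) \in N') ->
  mod_isomorphic (subquot U N) (subquot U' N').
Proof.
move=> g_lin g_surj gN.
have gB x y : g (x - y) = g x - g y.
  by rewrite addrC -scaleN1r g_lin scaleN1r addrC.
pose pi := @modquot_pi A _ (trace_submod U N).
pose pi' := @modquot_pi A _ (trace_submod U' N').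
pose phi (q : subquot U N) : subquot U' N' := pi' (g (modquot_repr q)).
have phiE x : phi (pi x) = pi' (g x).
  apply/modquot_piE; rewrite -gB; apply/gN.
  suff : modquot_repr (pi x) - x \in trace_submod U N by [].
  by apply/modquot_piE; rewrite modquot_piK.
have phi_lin : linear phi.
  move=> a p q; rewrite -[p]modquot_piK -[q]modquot_piK.
  have -> : a *: modquot_pi _ (modquot_repr p) + modquot_pi _ (modquot_repr q)
      = pi (a *: modquot_repr p + modquot_repr q).
    by rewrite /pi linearP.
  by rewrite !phiE g_lin /pi' linearP.
pose phiL := GRing.isLinear.Build A (subquot U N) (subquot U' N') *:%R phi phi_lin.
exists (HB.pack phi phiL : {linear subquot U N -> subquot U' N'}) => /=.
have phi_inj : injective phi.
  move=> p q; rewrite -[p]modquot_piK -[q]modquot_piK !phiE => /modquot_piE.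
  by rewrite -gB => /gN pq; apply/modquot_piE.
have phi_surj (y : subquot U' N') : exists x, phi x = y.
  have [x gx] := g_surj (modquot_repr y); exists (pi x).
  by rewrite phiE gx /pi' modquot_piK.
have [psi psiK] := boolp.choice phi_surj.
by exists psi => // x; apply: phi_inj; rewrite psiK.
Qed.

(** * Sign Specht modules *)

(** The Young symmetrizer [b_T a_T] of a column tableau, whose row stabilizer is
    trivial. *)
Definition sign_elt n : ZS n := [ffun s : 'S_n => (-1) ^+ odd_perm s].

Lemma ZS_mul_sign n (u : ZS n) : u * sign_elt n = sign_elt n *~ sign_char u.
Proof.
apply/ffunP => g; rewrite [LHS]ffunE ffunMzE ffunE mulrzz mulr_sumr.
apply: eq_bigr => s _; rewrite ffunE odd_permM odd_permV signr_addb.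
by rewrite mulrCA mulrA.
Qed.

Lemma shape_column (X : Type) k (T : seq (seq X)) :
  shape T = nseq k 1%N -> T = [seq [:: i] | i <- flatten T].
Proof. by elim: T k => [|[|i [|j r]] T IH] [|k] //= [] /IH {1}->. Qed.

Lemma column_tableau n (T : seq (seq 'I_n)) :
  is_tableau (nseq n 1%N) T -> T = [seq [:: i] | i <- flatten T].
Proof. by case=> _ /shape_column. Qed.

Lemma column_row_of n (T : seq (seq 'I_n)) i :
  is_tableau (nseq n 1%N) T -> row_of T i = index i (flatten T).
Proof.
move=> /column_tableau {1}->; rewrite /row_of find_map; apply: eq_find => j.
by rewrite /= inE eq_sym.
Qed.

Lemma column_col_of n (T : seq (seq 'I_n)) i :
  is_tableau (nseq n 1%N) T -> col_of T i = 0%N.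
Proof.
move=> TT; have [_ _ permT] := TT.
have iT : i \in flatten T by rewrite (perm_mem permT) mem_enum.
rewrite /col_of (column_row_of i TT) [X in nth _ X](column_tableau TT).
by rewrite (nth_map i) ?index_mem // nth_index //= eqxx.
Qed.

Lemma column_young_symmetrizer n (T : seq (seq 'I_n)) :
  is_tableau (nseq n 1%N) T -> tab_b T * tab_a T = sign_elt n.
Proof.
move=> TT; have -> : tab_a T = 1.
  apply/ffunP => s; rewrite !ffunE inE; congr (nat_of_bool _)%:R.
  apply/forallP/eqP => [sT|-> i]; last by rewrite perm1.
  apply/permP => i; rewrite perm1; have := eqP (sT i).
  rewrite !column_row_of // => /index_inj; have [_ _ permT] := TT.
  by apply; rewrite ?(perm_mem permT) ?mem_enum.
rewrite mulr1; apply/ffunP => s; rewrite !ffunE inE ifT //.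
by apply/forallP => i; rewrite !column_col_of.
Qed.

Lemma sign_elt_mulrz_inj n : injective (fun k : int => sign_elt n *~ k).
Proof.
move=> j k /ffunP/(_ 1%g); rewrite !ffunMzE !ffunE odd_perm1 expr0.
by rewrite !intz.
Qed.

Lemma spechtP n (T : seq (seq 'I_n)) (x : ZS n) :
  is_tableau (nseq n 1%N) T ->
  x \in specht T <-> exists k : int, x = sign_elt n *~ k.
Proof.
move=> TT; split=> [/asboolP[u]|[k ->]].
  rewrite column_young_symmetrizer // ZS_mul_sign => ->.
  by exists (sign_char u).
apply/asboolP; exists (1 *~ k).
by rewrite column_young_symmetrizer // mulrzAl mul1r.
Qed.

Lemma specht_nmulP n (T : seq (seq 'I_n)) l (k : int) :
  is_tableau (nseq n 1%N) T ->
  (sign_elt n *~ k : (ZS n)^o) \in nmul l (specht T) <-> (l %| k)%Z.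
Proof.
move=> TT; split=> [/asboolP[y /(spechtP _ TT)[j ->]]|/dvdzP[j ->]].
  rewrite pmulrn -mulrzA => /sign_elt_mulrz_inj ->.
  exact: dvdz_mull.
apply/asboolP; exists (sign_elt n *~ j); last by rewrite pmulrn -mulrzA.
by apply/(spechtP _ TT); exists j.
Qed.

(** * The two quotients *)

Lemma proper_quotient_even (R : comPzRingType) l m (T : seq (seq 'I_(2 * m))) :
  has_char R l -> odd l \/ l = 0%N -> (0 < m)%N ->
  is_tableau (nseq (2 * m) 1%N) T ->
  mod_isomorphic
    (subquot (gamma (2 * m))
       (cap (gamma (2 * m)) (ident (grassmann R) (2 * m))))
    (subquot (specht T) (nmul l (specht T))).
Proof.
move=> charR l_odd m0 TT.
have [d d2 [[f0 f0d] dvd_d]] := gamma_alt_gen m0.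
have d0 : d%:Z != 0 by apply: contraTneq d2 => -[->]; rewrite dvd0n expn_eq0.
set n := (2 * m)%N in T TT f0 f0d dvd_d *.
pose k (f : submod (gamma n)) := (gamma_alt f %/ d)%Z.
have kE f : gamma_alt f = k f * d by rewrite /k divzK.
have signS j : (sign_elt n *~ j : (ZS n)^o) \in specht T.
  by apply/(spechtP _ TT); exists j.
apply: (mod_isomorphic_subquot (g := fun f => Submod (signS (k f)))).
- move=> u f g; apply: val_inj.
  transitivity (u * (sign_elt n *~ k f) + sign_elt n *~ k g) => //=.
  have -> : k (u *: f + g) = sign_char u * k f + k g.
    apply: (mulIf d0); rewrite mulrDl -mulrA -!kE raddfD /=.
    congr (_ + _); apply: alt_coef_ZS_act.
    by have /gammaP[] := valP f.
  by rewrite mulrzDr mulrzA -ZS_mul_sign -mulrzAr.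
- case=> y yS; have [j yE] := (spechtP _ TT).1 yS; exists (f0 *~ j).
  apply: val_inj => /=; rewrite yE; congr (_ *~ _).
  by apply: (mulIf d0); rewrite -kE raddfMz /= f0d mulrzz mulrC.
- move=> f; rewrite (specht_nmulP _ _ TT).
  have l_cop : (l %| k f)%Z = (l %| gamma_alt f)%Z.
    case: l_odd {charR} => [l_odd|->].
      rewrite kE Gauss_dvdzl // coprimezE /= (coprime_dvdr d2) // coprimeXr //.
      by rewrite coprimen2.
    by rewrite !dvd0z kE mulf_eq0 (negbTE d0) orbF.
  rewrite l_cop -(ident_gamma charR _ (valP f)) ?muln_gt0 //.
  by rewrite [val f \in cap _ _]andb_idl // => _; apply: valP.
Qed.

Lemma proper_quotient_odd (R : comPzRingType) l n
    (x : subquot (gamma n) (cap (gamma n) (ident (grassmann R) n))) :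
  has_char R l -> odd n -> x = 0.
Proof.
move=> charR n_odd; rewrite -[x]modquot_piK.
set f := modquot_repr x; rewrite -[0](raddf0 (modquot_pi (trace_submod _ _))).
apply/modquot_piE; rewrite subr0; have fG := valP f.
apply/andP; split=> //; apply/(ident_gamma charR _ fG); first by case: (n) n_odd.
by have /gammaP[fM fP] := fG; rewrite (alt_coef_proper_odd n_odd fM fP) dvdz0.
Qed.

Close Scope ring_scope.

Theorem theorem9 (R : comPzRingType) (l : nat) (char_R : has_char R l)
    (l_odd0 : odd l \/ l = 0%N) :
  (forall m : nat, (0 < m)%N ->
   forall T : seq (seq 'I_(2 * m)), is_tableau (nseq (2 * m) 1%N) T ->
     mod_isomorphic
       (subquot (gamma (2 * m))
                (cap (gamma (2 * m)) (ident (grassmann R) (2 * m))))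
       (subquot (specht T) (nmul l (specht T)))) /\
  (forall m : nat,
   forall x : subquot (gamma (2 * m).+1)
                (cap (gamma (2 * m).+1) (ident (grassmann R) (2 * m).+1)),
     x = 0%R).
Proof.
split=> [m m0 T TT|m x]; first exact: proper_quotient_even.
by apply: (proper_quotient_odd _ char_R); rewrite mul2n /= odd_double.
Qed.
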